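(* Let $R$ be a Kähler algebraic curvature operator on a complex Euclidean vector space $(V,g,J)$ of complex dimension $m\geq1$, with scalar curvature $S$, and let $\{e_1,\dots,e_m,Je_1,\dots,Je_m\}$ be an orthonormal basis of $V$. Define $$\varphi^-_{ij}=\tfrac12\left(e_i\odot e_j+Je_i\odot Je_j\right),\qquad \psi^-_{ij}=\tfrac12\left(e_i\odot Je_j-Je_i\odot e_j\right)\qquad(1\leq i<j\leq m),$$ and, for $1\leq k\leq m-1$, $$\eta_k=\frac{k}{\sqrt{8k(k+1)}}\left(e_{k+1}\odot e_{k+1}+Je_{k+1}\odot Je_{k+1}\right)-\frac{1}{\sqrt{8k(k+1)}}\sum_{i=1}^k\left(e_i\odot e_i+Je_i\odot Je_i\right).$$ Then $$\sum_{1\leq i<j\leq m}\left(\mathring{R}(\varphi^-_{ij},\varphi^-_{ij})+\mathring{R}(\psi^-_{ij},\psi^-_{ij})\right)+\sum_{k=1}^{m-1}\mathring{R}(\eta_k,\eta_k)=-\frac{m-1}{2m}S.$$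
   Context: A complex Euclidean vector space $(V,g,J)$ of complex dimension $m$ is a real inner product space $(V,g)$ of real dimension $2m$ with an endomorphism $J$ satisfying $J^2=-\operatorname{id}$ and $g(JX,JY)=g(X,Y)$. An algebraic curvature operator on $V$ is a 4-linear form $R$ on $V$ with $R(X,Y,Z,W)=-R(Y,X,Z,W)=-R(X,Y,W,Z)=R(Z,W,X,Y)$ and satisfying the first Bianchi identity $R(X,Y,Z,W)+R(Y,Z,X,W)+R(Z,X,Y,W)=0$. It is called Kähler if moreover $R(X,Y,Z,W)=R(X,Y,JZ,JW)$ for all $X,Y,Z,W\in V$. The sign convention is that $R(X,Y,X,Y)$ is the sectional curvature for orthonormal $X,Y$; the scalar curvature is $S=\sum_{a,b}R(E_a,E_b,E_a,E_b)$ for an orthonormal basis $\{E_a\}$ of $V$. $V$ is identified with $V^*$ via $g$, with $(e_i\otimes e_j)(e_k,e_l)=\delta_{ik}\delta_{jl}$ for an orthonormal basis, and $u\odot v=u\otimes v+v\otimes u$. The curvature operator of the second kind is the symmetric bilinear form on traceless symmetric two-tensors given in an orthonormal basis of $V$ by $\mathring{R}(\varphi,\psi)=\sum_{i,j,k,l}R_{ijkl}\varphi_{il}\psi_{jk}$. *)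

(* Defs.v *)
From HB Require Import structures.
From mathcomp Require Import all_boot all_order all_algebra.
From mathcomp Require Import reals.

Set Implicit Arguments.
Unset Strict Implicit.
Unset Printing Implicit Defensive.

Import Order.TTheory GRing.Theory Num.Theory.
Local Open Scope ring_scope.

Section Definitions.
Variables (K : realType) (V : vectType K).

Implicit Types (g : {dot V for idfun}) (J : 'End(V)).
Implicit Types (R : V -> V -> V -> V -> K) (phi psi : V -> V -> K).

(* (V, g, J) has complex dimension m; the inner product on V is g itself. *)
Definition complex_euclidean g J (m : nat) : Prop :=
  [/\ \dim (fullv : {vspace V}) = (2 * m)%N,
      forall X, J (J X) = - X
    & forall X Y, g (J X) (J Y) = g X Y].

Definition multilinear4 R : Prop :=
  [/\ forall Y Z W, scalar (fun X => R X Y Z W),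
      forall X Z W, scalar (fun Y => R X Y Z W),
      forall X Y W, scalar (fun Z => R X Y Z W)
    & forall X Y Z, scalar (fun W => R X Y Z W)].

Record algebraic_curvature_operator R : Prop := AlgebraicCurvatureOperator {
  aco_multilinear : multilinear4 R;
  aco_antisym12 : forall X Y Z W, R X Y Z W = - R Y X Z W;
  aco_antisym34 : forall X Y Z W, R X Y Z W = - R X Y W Z;
  aco_pair_sym : forall X Y Z W, R X Y Z W = R Z W X Y;
  aco_bianchi : forall X Y Z W, R X Y Z W + R Y Z X W + R Z X Y W = 0
}.

Definition kaehler J R : Prop :=
  algebraic_curvature_operator R /\
  forall X Y Z W, R X Y Z W = R X Y (J Z) (J W).

Definition orthonormal_basis g (I : finType) (E : I -> V) : Prop :=
  (forall a b, g (E a) (E b) = (a == b)%:R) /\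
  basis_of fullv [seq E a | a : I].

(* The family e_1, ..., e_m, J e_1, ..., J e_m. *)
Definition complex_frame J (m : nat) (e : 'I_m -> V) (a : 'I_m + 'I_m) : V :=
  match a with inl i => e i | inr i => J (e i) end.

Definition scalar_curvature R (I : finType) (E : I -> V) : K :=
  \sum_a \sum_b R (E a) (E b) (E a) (E b).

(* Two-tensors are bilinear forms on V, through the identification of V with
   its dual by g. *)
Definition tensor g (u v : V) : V -> V -> K := fun X Y => g u X * g v Y.

Definition odot g (u v : V) : V -> V -> K :=
  fun X Y => tensor g u v X Y + tensor g v u X Y.

(* The curvature operator of the second kind, computed in the orthonormal
   basis E; phi and psi are meant to be traceless symmetric. *)
Definition curvature_second_kind R (I : finType) (E : I -> V) phi psi : K :=
  \sum_i \sum_j \sum_k \sum_l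
    R (E i) (E j) (E k) (E l) * phi (E i) (E l) * psi (E j) (E k).

Section Tensors.
Variables (g : {dot V for idfun}) (J : 'End(V)) (m : nat) (e : 'I_m -> V).

Definition phi_minus (i j : 'I_m) : V -> V -> K := fun X Y =>
  2^-1 * (odot g (e i) (e j) X Y + odot g (J (e i)) (J (e j)) X Y).

Definition psi_minus (i j : 'I_m) : V -> V -> K := fun X Y =>
  2^-1 * (odot g (e i) (J (e j)) X Y - odot g (J (e i)) (e j) X Y).

Definition diag_tensor (i : 'I_m) : V -> V -> K := fun X Y =>
  odot g (e i) (e i) X Y + odot g (J (e i)) (J (e i)) X Y.

(* Here e is numbered from 0, so e k is the vector written e_{k+1} when the
   numbering starts at 1, and e_1, ..., e_k are the e i with i < k. The tensor
   eta_k is defined for 1 <= k <= m - 1. *)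
Definition eta_tensor (k : 'I_m) : V -> V -> K := fun X Y =>
  k%:R / Num.sqrt (8 * k%:R * (k%:R + 1)) * diag_tensor k X Y
  - 1 / Num.sqrt (8 * k%:R * (k%:R + 1))
      * \sum_(i < m | (i < k)%N) diag_tensor i X Y.

End Tensors.

End Definitions.

(* Main.v *)
Require Import Defs.
From HB Require Import structures.
From mathcomp Require Import all_boot all_order all_algebra.
From mathcomp Require Import reals.
From mathcomp Require Import ring lra zify.

(** The tensors [phi^-_ij], [psi^-_ij] and [eta_k] form an orthonormal basis of
    the traceless J-invariant symmetric two-tensors. Since
    [Rring (u (x) v) (w (x) x) = R u w x v], everything is expressed through the
    bisectional curvature [B x y = R x (J x) y (J y)
    = R x y x y + R x (J y) x (J y)]: the pair [phi^-_ij], [psi^-_ij]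
    contributes [- 2 B e_i e_j], and the diagonal tensors satisfy
    [Rring D_i D_j = - 8 B e_i e_j]. The [eta_k] are the Helmert combinations of
    the [D_i / sqrt 8], so their contribution is minus the trace of
    [B e_i e_j] plus [1 / m] times the sum of all its entries. The result follows
    from [S = 2 \sum_(i, j) B e_i e_j], as [S] may be computed in the complex
    frame. *)

Set Implicit Arguments.
Unset Strict Implicit.
Unset Printing Implicit Defensive.

Import Order.TTheory GRing.Theory Num.Theory.
Local Open Scope ring_scope.

(** * Orthonormal expansions and basis independence of traces *)

Section OrthonormalBases.
Variables (K : realType) (V : vectType K) (g : {dot V for idfun}).

Lemma scalar_sumZ (f : V -> K) (I : Type) (r : seq I) (c : I -> K)
    (v : I -> V) :
  scalar f -> f (\sum_(i <- r) c i *: v i) = \sum_(i <- r) c i * f (v i).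
Proof.
move=> fL; elim: r => [|i r IHr]; last by rewrite !big_cons fL IHr.
by rewrite !big_nil; have := fL (-1) 0 0; rewrite scaler0 addr0 mulN1r addNr.
Qed.

Lemma dot_sym (X Y : V) : g X Y = g Y X.
Proof. by rewrite (hermC g) expr0 mul1r. Qed.

Lemma orthonormal_expansion (I : finType) (E : I -> V) (X : V) :
  orthonormal_basis g E -> X = \sum_a g X (E a) *: E a.
Proof.
move=> [gE /andP[/eqP spanE _]].
(* The remainder [Y] is orthogonal to every [E a], hence to their span and to itself; definiteness
   of [g] gives [Y = 0]. *)
apply/eqP; rewrite -subr_eq0; set Y := X - _.
have YE a : g Y (E a) = 0.
  rewrite linearBl linear_sumlz /= (bigD1 a) //= big1 => [|b ba].
    by rewrite linearZl_LR /= gE eqxx mulr1 addr0 subrr.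
  by rewrite linearZl_LR /= gE (negbTE ba) mulr0.
apply: contraT => /(neq0_dnorm_gt0 (s := g)).
suff -> : g Y Y = 0 by rewrite ltxx.
have /coord_span Ydec : Y \in <<in_tuple [seq E a | a : I]>>%VS.
  by rewrite spanE memvf.
rewrite {2}Ydec linear_sumr big1 // => i _; rewrite linearZr_LR /=.
have /mapP[a _ ->] := mem_nth 0 (ltn_ord i).
by rewrite YE mulr0.
Qed.

Lemma scalar_expansion (I : finType) (E : I -> V) (f : V -> K) (X : V) :
  orthonormal_basis g E -> scalar f -> f X = \sum_a g X (E a) * f (E a).
Proof.
by move=> onE fL; rewrite {1}(orthonormal_expansion X onE) scalar_sumZ.
Qed.

(** Expanding the first slot in [F] gives coefficients [g (E a) (F b)]; summed over [a], they
    rebuild [F b] in the second slot. *)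
Lemma trace_basis_indep (I I' : finType) (E : I -> V) (F : I' -> V)
    (B : V -> V -> K) :
  orthonormal_basis g E -> orthonormal_basis g F ->
  (forall Y, scalar (B^~ Y)) -> (forall X, scalar (B X)) ->
  \sum_a B (E a) (E a) = \sum_b B (F b) (F b).
Proof.
move=> onE onF Bl Br.
transitivity (\sum_a \sum_b g (E a) (F b) * B (F b) (E a)).
  by apply: eq_bigr => a _; rewrite (scalar_expansion _ onF (Bl (E a))).
rewrite exchange_big; apply: eq_bigr => b _ /=.
rewrite [RHS](scalar_expansion _ onE (Br (F b))).
by apply: eq_bigr => a _; rewrite dot_sym.
Qed.

Lemma scalar_curvature_basis_indep (I I' : finType) (E : I -> V) (F : I' -> V)
    (R : V -> V -> V -> V -> K) :
  multilinear4 R -> orthonormal_basis g E -> orthonormal_basis g F ->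
  scalar_curvature R E = scalar_curvature R F.
Proof.
move=> [R1 R2 R3 R4] onE onF; rewrite /scalar_curvature.
(* The scalar curvature is an iterated trace, so the basis is changed in one pair of slots at a
   time. *)
transitivity (\sum_a \sum_b R (E a) (F b) (E a) (F b)).
  apply: eq_bigr => a _.
  exact: (trace_basis_indep (B := fun X Y => R (E a) X (E a) Y) onE onF).
rewrite exchange_big [RHS]exchange_big; apply: eq_bigr => b _ /=.
exact: (trace_basis_indep (B := fun X Y => R X (F b) Y (F b)) onE onF).
Qed.

End OrthonormalBases.

(** * Bilinearity of the second-kind form and its values on decomposable tensors *)

Section SecondKind.
Variables (K : realType) (V : vectType K) (g : {dot V for idfun}).
Variables (I : finType) (E : I -> V) (R : V -> V -> V -> V -> K).
Local Notation Rring := (curvature_second_kind R E).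

Lemma second_kind_suml (T : Type) (r : seq T) (P : pred T) (c : T -> K)
    (f : T -> V -> V -> K) (phi psi : V -> V -> K) :
  (forall X Y, phi X Y = \sum_(p <- r | P p) c p * f p X Y) ->
  Rring phi psi = \sum_(p <- r | P p) c p * Rring (f p) psi.
Proof.
move=> phiE; rewrite /curvature_second_kind; symmetry.
under eq_bigr do rewrite mulr_sumr.
rewrite exchange_big; apply: eq_bigr => i _ /=.
under eq_bigr do rewrite mulr_sumr.
rewrite exchange_big; apply: eq_bigr => j _ /=.
under eq_bigr do rewrite mulr_sumr.
rewrite exchange_big; apply: eq_bigr => k _ /=.
under eq_bigr do rewrite mulr_sumr.
rewrite exchange_big; apply: eq_bigr => l _ /=.
rewrite phiE mulr_sumr mulr_suml; apply: eq_bigr => p _; ring.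
Qed.

Lemma second_kind_sumr (T : Type) (r : seq T) (P : pred T) (c : T -> K)
    (f : T -> V -> V -> K) (phi psi : V -> V -> K) :
  (forall X Y, psi X Y = \sum_(p <- r | P p) c p * f p X Y) ->
  Rring phi psi = \sum_(p <- r | P p) c p * Rring phi (f p).
Proof.
move=> psiE; rewrite /curvature_second_kind; symmetry.
under eq_bigr do rewrite mulr_sumr.
rewrite exchange_big; apply: eq_bigr => i _ /=.
under eq_bigr do rewrite mulr_sumr.
rewrite exchange_big; apply: eq_bigr => j _ /=.
under eq_bigr do rewrite mulr_sumr.
rewrite exchange_big; apply: eq_bigr => k _ /=.
under eq_bigr do rewrite mulr_sumr.
rewrite exchange_big; apply: eq_bigr => l _ /=.
rewrite psiE mulr_sumr; apply: eq_bigr => p _; ring.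
Qed.

Lemma second_kind_tensor (u v w x : V) :
  multilinear4 R -> orthonormal_basis g E ->
  Rring (tensor g u v) (tensor g w x) = R u w x v.
Proof.
move=> [R1 R2 R3 R4] onE; rewrite (scalar_expansion u onE (R1 w x v)).
apply: eq_bigr => i _.
rewrite (scalar_expansion w onE (R2 (E i) x v)) mulr_sumr.
apply: eq_bigr => j _.
rewrite (scalar_expansion x onE (R3 (E i) (E j) v)) !mulr_sumr.
apply: eq_bigr => k _.
rewrite (scalar_expansion v onE (R4 (E i) (E j) (E k))) !mulr_sumr.
by apply: eq_bigr => l _; rewrite /tensor; ring.
Qed.

(** Encoding a tensor as a list of weighted pairs [(c, u, v)] reduces each evaluation below to a
    finite sum of curvature values. *)
Lemma second_kind_tensor_sum (s t : seq (K * V * V)) (phi psi : V -> V -> K) :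
  multilinear4 R -> orthonormal_basis g E ->
  (forall X Y, phi X Y = \sum_(p <- s) p.1.1 * tensor g p.1.2 p.2 X Y) ->
  (forall X Y, psi X Y = \sum_(q <- t) q.1.1 * tensor g q.1.2 q.2 X Y) ->
  Rring phi psi =
    \sum_(p <- s) \sum_(q <- t) p.1.1 * q.1.1 * R p.1.2 q.1.2 q.2 p.2.
Proof.
move=> RL onE phiE psiE; rewrite (second_kind_suml _ phiE).
apply: eq_bigr => p _; rewrite (second_kind_sumr _ psiE) mulr_sumr.
by apply: eq_bigr => q _; rewrite second_kind_tensor // mulrA.
Qed.

End SecondKind.

(* Summing the squares of the Helmert vectors, which form an orthonormal basis
   of the complement of (1, ..., 1). The term k = 0 vanishes since 0^-1 = 0. *)
Lemma helmert_trace (K : realType) (q : nat -> nat -> K) (n : nat) :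
  (forall i j, q i j = q j i) ->
  \sum_(k < n.+1) (k%:R * (k%:R + 1))^-1 *
     (k%:R ^+ 2 * q k k - 2 * k%:R * \sum_(i < k) q k i
      + \sum_(i < k) \sum_(j < k) q i j)
  = \sum_(i < n.+1) q i i - n.+1%:R^-1 * \sum_(i < n.+1) \sum_(j < n.+1) q i j.
Proof.
move=> qC; elim: n => [|n IHn].
  by rewrite !big_ord1 mul0r invr0 mul0r invr1 mul1r subrr.
rewrite big_ord_recr IHn [in RHS]big_ord_recr /=.
(* Split off the last row and column, which agree by symmetry. *)
have -> : \sum_(i < n.+2) \sum_(j < n.+2) q i j =
    \sum_(i < n.+1) \sum_(j < n.+1) q i j
    + 2 * \sum_(i < n.+1) q n.+1 i + q n.+1 n.+1.
  rewrite big_ord_recr /= [X in _ + X]big_ord_recr /=.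
  under eq_bigr do rewrite big_ord_recr /= [q _ n.+1]qC.
  rewrite big_split /=; ring.
rewrite -(natr1 n.+1).
have n0 : n.+1%:R != 0 :> K by rewrite pnatr_eq0.
have n1 : n.+1%:R + 1 != 0 :> K by rewrite natr1 pnatr_eq0.
move: (n.+1%:R : K) n0 n1 => N n0 n1.
by field; rewrite n1 n0.
Qed.

(** * Symmetries of a Kähler curvature operator *)

Section KaehlerIdentities.
Variables (K : realType) (V : vectType K) (g : {dot V for idfun}).
Variables (J : 'End(V)) (R : V -> V -> V -> V -> K).
Hypotheses (JJ : forall X, J (J X) = - X) (RK : kaehler J R).

Lemma kaehler_multilinear : multilinear4 R.
Proof. by have [[]] := RK. Qed.

(* The holomorphic bisectional curvature, by the Bianchi identity. *)
Definition bisectional (x y : V) : K := R x y x y + R x (J y) x (J y).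

Lemma curvature_J34 x y z w : R x y (J z) (J w) = R x y z w.
Proof. by have [_ RJ] := RK; rewrite -RJ. Qed.

Lemma curvature_J12 x y z w : R (J x) (J y) z w = R x y z w.
Proof.
have [Rop _] := RK.
by rewrite (aco_pair_sym Rop) curvature_J34 (aco_pair_sym Rop).
Qed.

Lemma curvature_opp3 x y z w : R x y (- z) w = - R x y z w.
Proof.
have [_ _ R3 _] := kaehler_multilinear.
have R0 : R x y 0 w = 0.
  by have := R3 x y w (-1) 0 0; rewrite scaler0 addr0 mulN1r addNr.
by have := R3 x y w (-1) z 0; rewrite R0 scaleN1r !addr0 mulN1r.
Qed.

Lemma curvature_moveJ34 x y z w : R x y (J z) w = - R x y z (J w).
Proof. by rewrite -curvature_J34 JJ curvature_opp3. Qed.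

Lemma curvature_moveJ12 x y z w : R (J x) y z w = - R x (J y) z w.
Proof.
have [Rop _] := RK.
by rewrite (aco_pair_sym Rop) curvature_moveJ34 (aco_pair_sym Rop).
Qed.

Lemma curvature_swapJ12 x y z w : R x (J y) z w = R y (J x) z w.
Proof.
have [Rop _] := RK.
by rewrite (aco_antisym12 Rop) curvature_moveJ12 opprK.
Qed.

Lemma curvature_swapJ34 x y z w : R x y z (J w) = R x y w (J z).
Proof.
have [Rop _] := RK.
by rewrite (aco_antisym34 Rop) curvature_moveJ34 opprK.
Qed.

Lemma curvature_diag12 x z w : R x x z w = 0.
Proof. by have [Rop _] := RK; have := aco_antisym12 Rop x x z w; lra. Qed.

Lemma bisectionalE x y : bisectional x y = R x (J x) y (J y).
Proof.
have [Rop _] := RK.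
(* The other two cyclic terms are [- R x (J y) x (J y)] and [- R x y x y]. *)
have := aco_bianchi Rop x (J x) y (J y).
rewrite curvature_moveJ12 (aco_antisym12 Rop y x) curvature_J34.
rewrite /bisectional; lra.
Qed.

Lemma bisectionalC x y : bisectional x y = bisectional y x.
Proof. by have [Rop _] := RK; rewrite !bisectionalE (aco_pair_sym Rop). Qed.

(** * Values of the second-kind form on the given tensors *)

Section Tensors.
Variables (I : finType) (E : I -> V) (m : nat) (e : 'I_m -> V).
Hypothesis onE : orthonormal_basis g E.
Local Notation Rring := (curvature_second_kind R E).

(** With [a = R x y x y], [b = R x (J y) x (J y)] and [B = a + b], each of the four tensors in [s]
    contributes [(a - B - b) / 4 = - b / 2]. *)
Lemma second_kind_phi_minus i j :
  Rring (phi_minus g J e i j) (phi_minus g J e i j)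
  = - 2 * R (e i) (J (e j)) (e i) (J (e j)).
Proof.
have [Rop _] := RK; set x := e i; set y := e j.
pose s := [:: (2^-1 : K, x, y); (2^-1, y, x);
              (2^-1, J x, J y); (2^-1, J y, J x)].
have sE X Y : phi_minus g J e i j X Y =
    \sum_(p <- s) p.1.1 * tensor g p.1.2 p.2 X Y.
  by rewrite !big_cons big_nil /= /phi_minus /odot -/x -/y; ring.
rewrite (second_kind_tensor_sum kaehler_multilinear onE sE sE).
rewrite !big_cons !big_nil /= !curvature_J12 !curvature_J34.
rewrite !curvature_moveJ12 !curvature_moveJ34 !curvature_diag12 ?JJ.
(* Bianchi eliminates [R x (J x) y (J y)]; the rewrites bring the remaining terms to a common
   form. *)
have := bisectionalE x y; rewrite /bisectional.
rewrite (curvature_swapJ12 y x) (curvature_swapJ34 _ _ y x).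
rewrite (aco_pair_sym Rop y (J y)) (aco_antisym12 Rop y x).
rewrite (aco_antisym34 Rop x y y).
lra.
Qed.

(** Here [a] and [b] trade places: each tensor in [s] contributes [(b - B - a) / 4 = - a / 2]. *)
Lemma second_kind_psi_minus i j :
  Rring (psi_minus g J e i j) (psi_minus g J e i j)
  = - 2 * R (e i) (e j) (e i) (e j).
Proof.
have [Rop _] := RK; set x := e i; set y := e j.
pose s := [:: (2^-1 : K, x, J y); (2^-1, J y, x);
              (- 2^-1, J x, y); (- 2^-1, y, J x)].
have sE X Y : psi_minus g J e i j X Y =
    \sum_(p <- s) p.1.1 * tensor g p.1.2 p.2 X Y.
  by rewrite !big_cons big_nil /= /psi_minus /odot -/x -/y; ring.
rewrite (second_kind_tensor_sum kaehler_multilinear onE sE sE).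
rewrite !big_cons !big_nil /= !curvature_J12 !curvature_J34.
rewrite !curvature_moveJ12 !curvature_moveJ34 !curvature_diag12.
have := bisectionalE x y; rewrite /bisectional.
rewrite (curvature_swapJ12 y x) (curvature_swapJ34 _ _ y x).
rewrite (aco_pair_sym Rop y (J y)) (aco_antisym12 Rop y x).
rewrite (aco_antisym34 Rop x y y).
lra.
Qed.

Lemma second_kind_diag i j :
  Rring (diag_tensor g J e i) (diag_tensor g J e j)
  = - 8 * bisectional (e i) (e j).
Proof.
have [Rop _] := RK.
(* The weight 2 comes from [odot g x x] being twice [tensor g x x]. *)
pose s x := [:: (2 : K, x, x); (2, J x, J x)].
have sE k X Y : diag_tensor g J e k X Y =
    \sum_(p <- s (e k)) p.1.1 * tensor g p.1.2 p.2 X Y.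
  by rewrite !big_cons big_nil /= /diag_tensor /odot; ring.
rewrite (second_kind_tensor_sum kaehler_multilinear onE (sE i) (sE j)).
rewrite !big_cons !big_nil /= !curvature_J12 !curvature_J34 /bisectional.
rewrite curvature_moveJ12 curvature_moveJ34 (curvature_swapJ34 _ _ (e j) (e i)).
rewrite (aco_antisym34 Rop _ _ (e j)).
lra.
Qed.

Lemma second_kind_eta (k : 'I_m) : (0 < k)%N ->
  Rring (eta_tensor g J e k) (eta_tensor g J e k)
  = - ((k%:R * (k%:R + 1))^-1 *
       (k%:R ^+ 2 * bisectional (e k) (e k)
        - 2 * k%:R * \sum_(i < m | (i < k)%N) bisectional (e k) (e i)
        + \sum_(i < m | (i < k)%N) \sum_(j < m | (j < k)%N)
            bisectional (e i) (e j))).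
Proof.
move=> k0; set D := diag_tensor g J e.
pose T X Y := \sum_(i < m | (i < k)%N) D i X Y.
have TE X Y : T X Y = \sum_(i < m | (i < k)%N) 1 * D i X Y.
  by apply: eq_bigr => i _; rewrite mul1r.
pose r : K := Num.sqrt (8 * k%:R * (k%:R + 1)).
have etaE X Y : eta_tensor g J e k X Y =
    \sum_(p <- [:: (k%:R / r, D k); (- (1 / r), T)]) p.1 * p.2 X Y.
  by rewrite !big_cons big_nil /= addr0 mulNr.
rewrite (second_kind_suml _ _ _ etaE) !big_cons big_nil /=.
rewrite !(second_kind_sumr _ _ _ etaE) !big_cons !big_nil /=.
rewrite !(second_kind_suml _ _ _ TE) (second_kind_sumr _ _ _ TE).
have kT : \sum_(i < m | (i < k)%N) 1 * Rring (D i) (D k)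
    = - 8 * \sum_(i < m | (i < k)%N) bisectional (e k) (e i).
  rewrite mulr_sumr; apply: eq_bigr => i _.
  by rewrite mul1r second_kind_diag bisectionalC.
have Tk : \sum_(i < m | (i < k)%N) 1 * Rring (D k) (D i)
    = - 8 * \sum_(i < m | (i < k)%N) bisectional (e k) (e i).
  by rewrite mulr_sumr; apply: eq_bigr => i _; rewrite mul1r second_kind_diag.
have TT : \sum_(i < m | (i < k)%N) 1 * Rring (D i) T
    = - 8 * \sum_(i < m | (i < k)%N) \sum_(j < m | (j < k)%N)
              bisectional (e i) (e j).
  rewrite mulr_sumr; apply: eq_bigr => i _.
  rewrite mul1r (second_kind_sumr _ _ _ TE) mulr_sumr.
  by apply: eq_bigr => j _; rewrite mul1r second_kind_diag.
rewrite kT Tk TT second_kind_diag.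
have k0' : 0 < k%:R :> K by rewrite ltr0n.
have r2 : r ^+ 2 = 8 * k%:R * (k%:R + 1).
  by rewrite sqr_sqrtr // !mulr_ge0 ?addr_ge0 // ltW.
have r0 : r != 0.
  by rewrite -sqrf_eq0 r2 !mulf_neq0 ?gt_eqF // ltr_wpDr.
(* The 8 under the square root cancels the factor [- 8] of [second_kind_diag]. *)
have -> : (k%:R * (k%:R + 1))^-1 = 8 / r ^+ 2.
  by rewrite r2; field; rewrite !gt_eqF // ltr_wpDr.
by field.
Qed.

End Tensors.

(** For fixed [i], [j], the four choices of inserting [J] give each summand of the bisectional
    curvature twice. *)
Lemma scalar_curvature_complex_frame (m : nat) (e : 'I_m -> V) :
  scalar_curvature R (complex_frame J e)
  = 2 * \sum_(i < m) \sum_(j < m) bisectional (e i) (e j).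
Proof.
rewrite /scalar_curvature big_sumType /= -big_split mulr_sumr /=.
apply: eq_bigr => i _; rewrite !big_sumType /= -!big_split mulr_sumr /=.
apply: eq_bigr => j _.
rewrite curvature_J12 curvature_J34 curvature_moveJ12 curvature_moveJ34.
by rewrite /bisectional; ring.
Qed.

End KaehlerIdentities.

(** * Assembling the trace *)

Lemma sum_sym_offdiag (K : realType) (m : nat) (q : 'I_m -> 'I_m -> K) :
  (forall i j, q i j = q j i) ->
  \sum_(i < m) \sum_(j < m) q i j
  = \sum_(i < m) q i i + 2 * \sum_(i < m) \sum_(j < m | (i < j)%N) q i j.
Proof.
move=> qC.
have -> : \sum_(i < m) \sum_(j < m) q i j = \sum_(i < m) (q i i +
    \sum_(j < m | (i < j)%N) q i j + \sum_(j < m | (j < i)%N) q i j).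
  apply: eq_bigr => i _; rewrite (bigD1 i) //= -addrA; congr (_ + _).
  rewrite (bigID (fun j : 'I_m => (i < j)%N)) /=.
  congr (_ + _); apply: eq_bigl => j; rewrite -val_eqE /= neq_ltn; lia.
rewrite !big_split /= [X in _ + X](_ : _ =
    \sum_(i < m) \sum_(j < m | (i < j)%N) q i j); first by ring.
rewrite (exchange_big_dep xpredT) //=; apply: eq_bigr => i _.
by apply: eq_bigr => j _; rewrite qC.
Qed.

Theorem lemma4p4 (K : realType) (V : vectType K) (g : {dot V for idfun})
    (J : 'End(V)) (m : nat) (R : V -> V -> V -> V -> K) (e : 'I_m -> V)
    (E F : 'I_(2 * m) -> V) :
  (1 <= m)%N ->
  complex_euclidean g J m ->
  kaehler J R ->
  orthonormal_basis g (complex_frame J e) ->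
  orthonormal_basis g E ->
  orthonormal_basis g F ->
  let Rring := curvature_second_kind R E in
  let S := scalar_curvature R F in
  \sum_(i < m) \sum_(j < m | (i < j)%N)
      (Rring (phi_minus g J e i j) (phi_minus g J e i j)
       + Rring (psi_minus g J e i j) (psi_minus g J e i j))
    + \sum_(k < m | (1 <= k)%N) Rring (eta_tensor g J e k) (eta_tensor g J e k)
  = - ((m%:R - 1) / (2 * m%:R)) * S.
Proof.
case: m e E F => // n e E F _ [_ JJ _] RK one onE onF Rring S.
have -> : S = 2 * \sum_(i < n.+1) \sum_(j < n.+1) bisectional J R (e i) (e j).
  rewrite -(scalar_curvature_complex_frame JJ RK).
  exact: scalar_curvature_basis_indep (kaehler_multilinear RK) onF one.
have -> : \sum_(i < n.+1) \sum_(j < n.+1 | (i < j)%N)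
      (Rring (phi_minus g J e i j) (phi_minus g J e i j)
       + Rring (psi_minus g J e i j) (psi_minus g J e i j))
    = - 2 * \sum_(i < n.+1) \sum_(j < n.+1 | (i < j)%N)
              bisectional J R (e i) (e j).
  rewrite mulr_sumr; apply: eq_bigr => i _; rewrite mulr_sumr.
  apply: eq_bigr => j _.
  rewrite /Rring (second_kind_phi_minus JJ RK _ onE).
  rewrite (second_kind_psi_minus JJ RK _ onE).
  by rewrite /bisectional; ring.
have -> : \sum_(k < n.+1 | (1 <= k)%N)
      Rring (eta_tensor g J e k) (eta_tensor g J e k)
    = - (\sum_(i < n.+1) bisectional J R (e i) (e i)
         - n.+1%:R^-1 *
           \sum_(i < n.+1) \sum_(j < n.+1) bisectional J R (e i) (e j)).
  (* [helmert_trace] takes natural-number indices, so the matrix is extended through [inord]. *)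
  pose q i j := bisectional J R (e (inord i)) (e (inord j)).
  have qE (i j : 'I_n.+1) : bisectional J R (e i) (e j) = q i j.
    by rewrite /q !inord_val.
  rewrite [X in - (X - _)](_ : _ = \sum_(i < n.+1) q i i); last first.
    by apply: eq_bigr => i _; rewrite qE.
  rewrite [X in _ - (_ * X)](_ : _ = \sum_(i < n.+1) \sum_(j < n.+1) q i j);
    last by apply: eq_bigr => i _; apply: eq_bigr => j _; rewrite qE.
  rewrite -helmert_trace; last by move=> i j; exact: bisectionalC.
  rewrite -sumrN big_mkcond; apply: eq_bigr => k _.
  have kn := ltnW (ltn_ord k).
  (* The index [k = 0], absent from the eta sum, gives a zero Helmert term. *)
  have [-> |k0] := posnP k; first by rewrite mul0r invr0 mul0r oppr0.
  rewrite /Rring (second_kind_eta JJ RK _ onE k0) qE.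
  congr (- (_ * (_ - _ * _ + _))).
    rewrite (big_ord_widen n.+1 (fun i => q k i)) //.
    by apply: eq_bigr => i _; rewrite qE.
  rewrite (big_ord_widen n.+1 (fun i => \sum_(j < k) q i j)) //.
  apply: eq_bigr => i _.
  rewrite (big_ord_widen n.+1 (fun j => q i j)) //.
  by apply: eq_bigr => j _; rewrite qE.
(* With diagonal sum [D], upper sum [O] and [T = D + 2 * O], the left side is
   [- 2 * O - D + T / N = - T * (N - 1) / N], while [S = 2 * T]. *)
rewrite [\sum_(i < n.+1) \sum_(j < n.+1) _]sum_sym_offdiag; last first.
  by move=> i j; exact: bisectionalC.
have n0 : n.+1%:R != 0 :> K by rewrite pnatr_eq0.
move: (n.+1%:R : K) n0 => N n0.
by field.
Qed.
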